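(* In the setting of the context (with (A1), (A2) holding for the principal's safe payoff $\theta$), suppose $\sigma<\bar\sigma(\theta)$. Then the principal benefits by delegating decision authority to an intermediary whose payoff from the safe option is smaller than her own: there exists $\theta_I^*\in(\mu,\theta)$ such that for every $\theta_I\in(\theta_I^*,\theta)$ (for which (A1), (A2) and $\sigma<\bar\sigma(\theta_I)$ hold with $\theta_I$ in place of $\theta$, so that the delegation equilibrium is defined), $$U(\theta_I|\theta)>U(\theta|\theta)=u_P^{FB}(\tau_M(\theta)).$$ Furthermore, if the principal delegates to such an intermediary, then in equilibrium she is never tempted to overrule the intermediary's chosen action: whenever the intermediary selects the risky action (following type-1 news at a time $s\in[0,\tau_P(\theta_I)]$) the principal, whose posterior belief that $\omega=1$ is $\mu_1(s|\theta_I)$, also prefers the risky action, i.e. $\mu_1(s|\theta_I)\ge\theta$; and whenever the intermediary selects the safe action (following type-0 news, when the belief that $\omega=1$ is $0$, or when stopping without news, when this belief is $\mu$) the principal also prefers the safe action.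
   Context: Parameters and primitives. $\theta\in(0,1)$, $\beta\in(0,\theta)$, $\beta<\mu<\theta$, $\rho>0$, $\sigma\in(0,1)$. $G$ is the CDF of a probability distribution on $[0,\infty)$ with continuous density $g$, $G(t)<1$ for all $t<\infty$, and strictly decreasing hazard rate $H_R(t)=g(t)/(1-G(t))$; $H_R(\infty)=\lim_{t\to\infty}H_R(t)$. For $\vartheta\in(\mu,1)$ let $\phi_P(\vartheta)=\frac{\rho\vartheta}{\mu(1-\vartheta)}$, and $\phi_A=\frac{\rho\mu}{\beta(1-\mu)}$. Assumptions for $\vartheta$: (A1) $H_R(0)>\phi_P(\vartheta)>H_R(\infty)$; (A2) $\phi_P(\vartheta)>\phi_A$. $\tau_P(\vartheta)$ is the unique solution of $H_R(\tau_P(\vartheta))=\phi_P(\vartheta)$. Interpretation. A risky action pays $\omega\in\{0,1\}$, $\Pr(\omega=1)=\mu$; the safe action pays the principal $\theta$, the intermediary $\theta_I$, the agent $\beta$. Real news revealing $\omega$ (type-$\omega$ news) arrives at a time with CDF $G$. With probability $\sigma$ the agent is manipulative and can fake type-1 news. When authority is delegated to an intermediary, the intermediary chooses when to stop (choosing safe) and how to respond to news, and the equilibrium with beneficial search between intermediary and agent is played; if $\vartheta=\theta_I$ is the safe payoff of the decision maker this equilibrium is as follows. Equilibrium with decision maker's safe payoff $\vartheta$. Let $H_A(s|\vartheta)=\frac{\mu(1-\vartheta)H_R(s)-\rho\vartheta}{\vartheta-\mu}$ and $\bar\sigma(\vartheta)=1-\exp\{-\int_0^{\tau_P(\vartheta)}H_A(s|\vartheta)ds\}$.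 If (A1), (A2) hold for $\vartheta$ and $\sigma<\bar\sigma(\vartheta)$, let $\tau_M(\vartheta)\in(0,\tau_P(\vartheta))$ be the unique solution of $1-\exp\{-\int_{\tau_M(\vartheta)}^{\tau_P(\vartheta)}H_A(s|\vartheta)ds\}=\sigma$. The (manipulative) agent's faking time has CDF $F_A(t|\vartheta)=\frac1\sigma(1-\exp\{-\int_{\tau_M(\vartheta)}^tH_A(s|\vartheta)ds\})$ on $[\tau_M(\vartheta),\tau_P(\vartheta)]$ ($0$ before, $1$ after), with density $f_A(\cdot|\vartheta)$ (its right derivative). The decision maker's stopping time has CDF $F_P(t|\vartheta)=1-\exp\{-\int_{\tau_M(\vartheta)}^t\frac{\beta(1-\mu)H_R(s)-\rho\mu}{\mu-\beta}ds\}$ on $[\tau_M(\vartheta),\tau_P(\vartheta))$, $0$ before $\tau_M(\vartheta)$, and $F_P(t|\vartheta)=1$ for $t\geq\tau_P(\vartheta)$ (an atom at $\tau_P(\vartheta)$); $f_P(\cdot|\vartheta)$ is its density on $[\tau_M(\vartheta),\tau_P(\vartheta))$. The decision maker selects safe after type-0 news and risky after type-1 news at every time. Principal's payoff under delegation. With $w_0^P(s|\theta_I)=(1-\mu)g(s)(1-\sigma F_A(s|\theta_I))$, $w_1^P(s|\theta_I)=\mu g(s)(1-\sigma F_A(s|\theta_I))+\sigma f_A(s|\theta_I)(1-G(s))$, $W_\phi^P(t|\theta_I)=(1-G(t))(1-\sigma F_A(t|\theta_I))$ and $$\mu_1(s|\theta_I)=\frac{\mu g(s)(1-\sigma F_A(s|\theta_I))+\mu\sigma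 f_A(s|\theta_I)(1-G(s))}{\mu g(s)(1-\sigma F_A(s|\theta_I))+\sigma f_A(s|\theta_I)(1-G(s))},$$ the principal's payoff given the intermediary's stopping time $t$ is $$u_P(t|\theta_I,\theta)=\int_0^te^{-\rho s}\{w_0^P(s|\theta_I)\theta+w_1^P(s|\theta_I)\mu_1(s|\theta_I)\}ds+e^{-\rho t}W_\phi^P(t|\theta_I)\theta,$$ and her expected payoff from delegating is $$U(\theta_I|\theta)=\int_{\tau_M(\theta_I)}^{\tau_P(\theta_I)}f_P(s|\theta_I)u_P(s|\theta_I,\theta)ds+\big(1-F_P(\tau_P(\theta_I)^-|\theta_I)\big)u_P(\tau_P(\theta_I)|\theta_I,\theta).$$ Her payoff without delegation is $U(\theta|\theta)=u_P^{FB}(\tau_M(\theta))$, where $u_P^{FB}(t)=\int_0^t e^{-\rho x}g(x)(\mu+(1-\mu)\theta)dx+e^{-\rho t}(1-G(t))\theta$. *)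

(* Defs.v *)
(* Stdlib reals with Coquelicot. *)
From Stdlib Require Import Reals.
From Coquelicot Require Import Coquelicot.
Open Scope R_scope.

(* [G] is the arrival-time CDF of real news and [g] its density; [sigma_man] is
   the probability that the agent is manipulative. *)
Record model := Model {
  mu : R;
  beta : R;
  rho : R;
  sigma_man : R;
  G : R -> R;
  g : R -> R
}.

(* Continuity of the density is required on [0, +oo) only, so one-sided at 0:
   [g] may jump there from the value 0 it would have on negative times. *)
Record cdf_with_continuous_density (F f : R -> R) : Prop := {
  density_ge0 : forall t, 0 <= t -> 0 <= f t;
  density_continuous : continuous_on (fun t => 0 <= t) f;
  cdf_negative : forall t, t < 0 -> F t = 0;
  cdf_density : forall t, 0 <= t -> is_RInt f 0 t (F t);
  cdf_total : is_lim F p_infty 1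
}.

(* Coquelicot's [iota P] is the unique point satisfying [P] when there is one. *)
Definition right_derivative (f : R -> R) (t : R) : R :=
  iota (fun l : R =>
    filterlim (fun h => (f (t + h) - f t) / h) (at_right 0) (locally l)).

Definition left_limit (f : R -> R) (t : R) : R :=
  iota (fun l : R => filterlim f (at_left t) (locally l)).

Section Equilibrium.

Context (M : model).

Definition hazard (t : R) : R := g M t / (1 - G M t).

Definition hazard_infty : Rbar := Lim hazard p_infty.

Definition phi_P (vt : R) : R := rho M * vt / (mu M * (1 - vt)).

Definition phi_A : R := rho M * mu M / (beta M * (1 - mu M)).

Definition assumption_A1 (vt : R) : Prop :=
  hazard 0 > phi_P vt /\ Rbar_lt hazard_infty (phi_P vt).

Definition assumption_A2 (vt : R) : Prop := phi_P vt > phi_A.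

Definition tau_P (vt : R) : R :=
  iota (fun t : R => 0 <= t /\ hazard t = phi_P vt).

Definition H_A (vt s : R) : R :=
  (mu M * (1 - vt) * hazard s - rho M * vt) / (vt - mu M).

Definition sigma_bar (vt : R) : R :=
  1 - exp (- RInt (H_A vt) 0 (tau_P vt)).

Definition tau_M (vt : R) : R :=
  iota (fun t : R =>
    0 < t < tau_P vt /\ 1 - exp (- RInt (H_A vt) t (tau_P vt)) = sigma_man M).

Definition F_A (vt t : R) : R :=
  if Rlt_dec t (tau_M vt) then 0
  else if Rle_dec t (tau_P vt)
  then / sigma_man M * (1 - exp (- RInt (H_A vt) (tau_M vt) t))
  else 1.

Definition f_A (vt : R) : R -> R := right_derivative (F_A vt).

Definition F_P (vt t : R) : R :=
  if Rlt_dec t (tau_M vt) then 0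
  else if Rlt_dec t (tau_P vt)
  then 1 - exp (- RInt (fun s =>
         (beta M * (1 - mu M) * hazard s - rho M * mu M) / (mu M - beta M))
         (tau_M vt) t)
  else 1.

(* The density of the absolutely continuous part; the atom at [tau_P vt]
   is accounted for separately in [delegation_payoff]. *)
Definition f_P (vt : R) : R -> R := right_derivative (F_P vt).

Definition w0 (vt s : R) : R :=
  (1 - mu M) * g M s * (1 - sigma_man M * F_A vt s).

Definition w1 (vt s : R) : R :=
  mu M * g M s * (1 - sigma_man M * F_A vt s)
  + sigma_man M * f_A vt s * (1 - G M s).

Definition W_phi (vt t : R) : R := (1 - G M t) * (1 - sigma_man M * F_A vt t).

Definition mu1 (vt s : R) : R :=
  (mu M * g M s * (1 - sigma_man M * F_A vt s)
   + mu M * sigma_man M * f_A vt s * (1 - G M s))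
  / (mu M * g M s * (1 - sigma_man M * F_A vt s)
     + sigma_man M * f_A vt s * (1 - G M s)).

Definition u_P (t thetaI theta : R) : R :=
  RInt (fun s => exp (- (rho M * s)) *
         (w0 thetaI s * theta + w1 thetaI s * mu1 thetaI s)) 0 t
  + exp (- (rho M * t)) * W_phi thetaI t * theta.

Definition delegation_payoff (thetaI theta : R) : R :=
  RInt (fun s => f_P thetaI s * u_P s thetaI theta) (tau_M thetaI) (tau_P thetaI)
  + (1 - left_limit (F_P thetaI) (tau_P thetaI))
    * u_P (tau_P thetaI) thetaI theta.

Definition first_best_payoff (theta t : R) : R :=
  RInt (fun x => exp (- (rho M * x)) * g M x * (mu M + (1 - mu M) * theta)) 0 t
  + exp (- (rho M * t)) * (1 - G M t) * theta.

Inductive action := Risky | Safe.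

(* The events upon which the intermediary takes an action, at time [s]:
   type-1 news, type-0 news, or stopping before any news. *)
Inductive decision_event := News1 (s : R) | News0 (s : R) | Stop (s : R).

Definition event_time (e : decision_event) : R :=
  match e with News1 s | News0 s | Stop s => s end.

Definition intermediary_action (e : decision_event) : action :=
  match e with News1 _ => Risky | News0 _ | Stop _ => Safe end.

(* The probability of [omega = 1] given the event. Without news it remains
   the prior, as neither news arrival nor faking time depends on [omega]. *)
Definition posterior (vt : R) (e : decision_event) : R :=
  match e with News1 s => mu1 vt s | News0 _ => 0 | Stop _ => mu M end.

Definition expected_payoff (theta p : R) (a : action) : R :=
  match a with Risky => p * 1 + (1 - p) * 0 | Safe => theta end.

Definition prefers (theta p : R) (a : action) : Prop :=
  forall b : action, expected_payoff theta p b <= expected_payoff theta p a.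

Definition never_tempted_to_overrule (thetaI theta : R) : Prop :=
  forall e : decision_event, 0 <= event_time e <= tau_P thetaI ->
    prefers theta (posterior thetaI e) (intermediary_action e).

End Equilibrium.

(* Main.v *)
(* On the support of stopping times, let E(s) = exp(-rho s)(1 - G(s)) and let
   S be the probability that faking has not occurred. With I = theta_I, the
   principal's payoff u_P(t) has derivative
   E S (theta - mu)(H_A(theta) - H_A(I)) in the stopping time t. It vanishes for
   I = theta, and for I < theta it is minus E S (theta - mu) d k, with
   k = mu((1 - mu) H_R - rho) > 0 and d = (theta - I)/((I - mu)(theta - mu)).
   Hence U(I|theta) >= u_P(tau_P(I)). Since H_A(I) = H_A(theta) + d k has the same
   integral over [tau_M(I), tau_P(I)] as H_A(theta) over
   [tau_M(theta), tau_P(theta)], tau_M(I) exceeds tau_M(theta), and the resulting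
   gain in u_P^FB is at least E(tau_M(I)) (theta - mu) d times the integral of k
   over [tau_M(I), tau_P(theta)]. The loss after tau_M(I) carries the strictly
   smaller factor E(s) S(s), which outweighs the excess
   tau_P(I) - tau_P(theta) -> 0. *)

Require Import Defs.
From Stdlib Require Import Reals Lra.
From Coquelicot Require Import Coquelicot.
Open Scope R_scope.

(** * Integrals of functions continuous on the whole line *)

Section ContinuousIntegrands.

Context (f : R -> R) (cont_f : forall x : R, continuous f x).

Lemma ex_RInt_cont (a b : R) : ex_RInt f a b.
Proof. apply (@ex_RInt_continuous R_CompleteNormedModule); auto. Qed.

Lemma RInt_split (b a c : R) : RInt f a c = RInt f a b + RInt f b c.
Proof.
  symmetry; apply (@RInt_Chasles R_CompleteNormedModule); apply ex_RInt_cont.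
Qed.

Lemma is_derive_primitive (a t : R) : is_derive (fun x => RInt f a x) t (f t).
Proof.
  apply (@is_derive_RInt R_NormedModule) with (a := a).
  - apply filter_forall; intros x.
    apply (@RInt_correct R_CompleteNormedModule), ex_RInt_cont.
  - apply cont_f.
Qed.

Lemma RInt_primitive (F : R -> R) (a b : R) :
  (forall x, is_derive F x (f x)) -> RInt f a b = F b - F a.
Proof.
  intros dF; apply (@is_RInt_unique R_CompleteNormedModule).
  apply (@is_RInt_derive R_CompleteNormedModule); auto.
Qed.

Lemma RInt_Rmult (c a b : R) :
  RInt (fun x => c * f x) a b = c * RInt f a b.
Proof. apply (@RInt_scal R_CompleteNormedModule), ex_RInt_cont. Qed.

Lemma RInt_le_const (c a b : R) :
  a <= b -> (forall x, a < x < b -> f x <= c) -> RInt f a b <= c * (b - a).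
Proof.
  intros ab fc.
  replace (c * (b - a)) with (RInt (fun _ => c) a b)
    by (rewrite (@RInt_const R_CompleteNormedModule); simpl; unfold scal; simpl;
        unfold mult; simpl; ring).
  apply RInt_le; auto.
  - apply ex_RInt_cont.
  - apply (@ex_RInt_const R_CompleteNormedModule).
Qed.

Lemma RInt_ge_const (c a b : R) :
  a <= b -> (forall x, a < x < b -> c <= f x) -> c * (b - a) <= RInt f a b.
Proof.
  intros ab fc.
  replace (c * (b - a)) with (RInt (fun _ => c) a b)
    by (rewrite (@RInt_const R_CompleteNormedModule); simpl; unfold scal; simpl;
        unfold mult; simpl; ring).
  apply RInt_le; auto.
  - apply (@ex_RInt_const R_CompleteNormedModule).
  - apply ex_RInt_cont.
Qed.

End ContinuousIntegrands.

(** * Continuity, one-sided derivatives and limits, unique descriptions *)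

Lemma derivable_continuous (f : R -> R) (l x : R) :
  is_derive f x l -> continuous f x.
Proof.
  intros df; apply (@ex_derive_continuous R_AbsRing R_NormedModule).
  now exists l.
Qed.

(* Coquelicot's lemmas restated over [R], so that the premises they leave have
   the syntactic form that [continuous_compound] looks for. *)
Lemma continuous_Rid (x : R) : continuous (fun t : R => t) x.
Proof. intros P HP; exact HP. Qed.

Lemma continuous_Rconst (c x : R) : continuous (fun _ : R => c) x.
Proof. apply continuous_const. Qed.

Lemma continuous_Rplus (f g : R -> R) (x : R) :
  continuous f x -> continuous g x -> continuous (fun t => f t + g t) x.
Proof. apply (@continuous_plus R_UniformSpace R_AbsRing R_NormedModule). Qed.

Lemma continuous_Rminus (f g : R -> R) (x : R) :
  continuous f x -> continuous g x -> continuous (fun t => f t - g t) x.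
Proof. apply (@continuous_minus R_UniformSpace R_AbsRing R_NormedModule). Qed.

Lemma continuous_Ropp (f : R -> R) (x : R) :
  continuous f x -> continuous (fun t => - f t) x.
Proof. apply (@continuous_opp R_UniformSpace R_AbsRing R_NormedModule). Qed.

Lemma continuous_Rmult (f g : R -> R) (x : R) :
  continuous f x -> continuous g x -> continuous (fun t => f t * g t) x.
Proof. apply (@continuous_mult R_UniformSpace R_AbsRing). Qed.

Lemma continuous_Rexp (f : R -> R) (x : R) :
  continuous f x -> continuous (fun t => exp (f t)) x.
Proof. apply continuous_exp_comp. Qed.

Ltac continuous_compound :=
  repeat match goal with
  | |- continuous (fun _ => ?c) _ => apply continuous_Rconst
  | |- continuous (fun x => x) _ => apply continuous_Rid
  | |- continuous (fun x => _ + _) _ => apply continuous_Rplus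
  | |- continuous (fun x => _ - _) _ => apply continuous_Rminus
  | |- continuous (fun x => - _) _ => apply continuous_Ropp
  | |- continuous (fun x => _ * _) _ => apply continuous_Rmult
  | |- continuous (fun x => _ / _) _ => apply continuous_Rmult
  | |- continuous (fun x => exp _) _ => apply continuous_Rexp
  | |- continuous (Rmult ?c) ?x => change (continuous (fun t => c * t) x)
  | |- continuous (Rminus ?c) ?x => change (continuous (fun t => c - t) x)
  end; auto.

Lemma locally_gt (f : R -> R) (c x : R) :
  continuous f x -> c < f x -> locally x (fun y => c < f y).
Proof. intros cf h; exact (cf _ (open_gt c (f x) h)). Qed.

(** Clamping at 0 is 1-Lipschitz with values in [[0, +oo)], so composing with it turns continuity
    relative to that half-line into continuity everywhere. *)
Lemma continuous_on_Rmax0 (f : R -> R) (t : R) :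
  continuous_on (fun x => 0 <= x) f -> continuous (fun x => f (Rmax 0 x)) t.
Proof.
  intros cf.
  refine (filterlim_comp _ _ _ (Rmax 0) f _ _ _ _ (cf (Rmax 0 t) (Rmax_l 0 t))).
  intros P [eps HP]; exists eps; intros y Hy; apply HP; [|apply Rmax_l].
  change (Rabs (Rmax 0 y - Rmax 0 t) < eps).
  change (Rabs (y - t) < eps) in Hy.
  apply Rle_lt_trans with (2 := Hy).
  unfold Rmax; repeat destruct Rle_dec; unfold Rabs;
    repeat destruct Rcase_abs; lra.
Qed.

(** Evaluates the [iota] through a smooth comparison function that has to match [f] only at [t] and
    just after it. This accommodates the kink of [F_A] at [tau_M] and the jump of [F_P] at [tau_P],
    on their right-hand branches. *)
Lemma right_derivative_eq (f phi : R -> R) (t l : R) :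
  is_derive phi t l -> f t = phi t ->
  (exists d : posreal, forall s, t < s < t + d -> f s = phi s) ->
  right_derivative f t = l.
Proof.
  intros dphi ft [d fphi].
  apply (@iota_filterlim_locally R_AbsRing R_CompleteNormedModule).
  { apply Proper_StrongProper, at_right_proper_filter. }
  apply is_derive_Reals in dphi.
  intros P [eps HP].
  destruct (dphi eps (cond_pos eps)) as [del Hdel].
  assert (hm : 0 < Rmin d del) by (apply Rmin_pos; apply cond_pos).
  exists (mkposreal _ hm); intros h Hh h0.
  change (Rabs (h - 0) < Rmin d del) in Hh.
  rewrite Rminus_0_r in Hh.
  pose proof (Rmin_l d del); pose proof (Rmin_r d del).
  apply HP; change (Rabs ((f (t + h) - f t) / h - l) < eps).
  rewrite ft, fphi; [apply Hdel|]; try lra.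
  rewrite (Rabs_pos_eq h) in Hh; lra.
Qed.

Lemma left_limit_eq (f phi : R -> R) (t : R) :
  continuous phi t ->
  (exists d : posreal, forall s, t - d < s < t -> f s = phi s) ->
  left_limit f t = phi t.
Proof.
  intros cphi [d fphi].
  apply (@iota_filterlim_locally R_AbsRing R_CompleteNormedModule).
  { apply Proper_StrongProper, at_left_proper_filter. }
  apply filterlim_ext_loc with phi.
  - exists d; intros s Hs st; symmetry; apply fphi.
    change (Rabs (s - t) < d) in Hs; apply Rabs_def2 in Hs; lra.
  - apply filterlim_filter_le_1 with (2 := cphi).
    apply filter_le_within.
Qed.

Lemma iota_eq (P : R -> Prop) (x : R) :
  P x -> (forall y, P y -> y = x) -> iota P = x.
Proof.
  intros Px uniq.
  now apply (@iota_unique R_AbsRing R_CompleteNormedModule).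
Qed.

(** Serves both faking and stopping: [Lam] is a cumulative hazard counted from 0, and [c] recentres
    it so that survival equals 1 at [tau_M]. *)
Lemma derive_survival (Lam : R -> R) (lam c t : R) :
  is_derive Lam t lam ->
  is_derive (fun s => exp (- (Lam s - c))) t (- (lam * exp (- (Lam t - c)))).
Proof.
  intros dL; auto_derive.
  - now exists lam.
  - change (Derive (fun x => Lam x) t) with (Derive Lam t).
    rewrite (is_derive_unique Lam t lam dL); unfold Rminus; ring.
Qed.


(** * The hazard rate on the whole line, and the threshold [tau_P] *)

Section Model.

Context (M : model)
  (hbeta : 0 < beta M) (hmu : beta M < mu M < 1) (hrho : 0 < rho M)
  (hsigma : 0 < sigma_man M < 1)
  (hG : cdf_with_continuous_density (G M) (g M))
  (hG1 : forall t : R, G M t < 1)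
  (hhazard : forall s t : R, 0 <= s -> s < t -> hazard M t < hazard M s).

(* [dens], [surv] and [haz] agree with [g], [1 - G] and the hazard rate for
   times [0 <= t], but are continuous on the whole line. *)
Definition dens (t : R) : R := g M (Rmax 0 t).

Definition surv (t : R) : R := 1 - RInt dens 0 t.

Definition haz (t : R) : R := dens t / surv t.

Lemma dens_g (t : R) : 0 <= t -> dens t = g M t.
Proof. now intros t0; unfold dens; rewrite Rmax_right. Qed.

Lemma dens_continuous (t : R) : continuous dens t.
Proof. apply continuous_on_Rmax0, hG. Qed.

Lemma dens_ge0 (t : R) : 0 <= dens t.
Proof. apply (density_ge0 _ _ hG), Rmax_l. Qed.

Lemma surv_G (t : R) : 0 <= t -> surv t = 1 - G M t.
Proof.
  intros t0; unfold surv; f_equal.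
  transitivity (RInt (g M) 0 t).
  - apply (@RInt_ext R_CompleteNormedModule); intros x.
    rewrite Rmin_left, Rmax_right by lra; intros hx; apply dens_g; lra.
  - apply (@is_RInt_unique R_CompleteNormedModule), hG, t0.
Qed.

Lemma surv_pos (t : R) : 0 < surv t.
Proof.
  destruct (Rle_lt_dec 0 t) as [t0|t0].
  - rewrite surv_G by lra; specialize (hG1 t); lra.
  (* At negative times the reversed integral makes [surv] at least 1. *)
  - unfold surv; assert (RInt dens 0 t = - RInt dens t 0) as ->.
    { pose proof (RInt_split dens dens_continuous t 0 0) as e.
      rewrite (@RInt_point R_CompleteNormedModule) in e.
      change (@zero _) with 0 in e; lra. }
    assert (0 <= RInt dens t 0); [|lra].
    apply RInt_ge_0; [lra|apply ex_RInt_cont, dens_continuous|].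
    intros; apply dens_ge0.
Qed.

Lemma dens_haz (t : R) : dens t = haz t * surv t.
Proof. unfold haz; field; pose proof (surv_pos t); lra. Qed.

Lemma surv_derive (t : R) : is_derive surv t (- (haz t * surv t)).
Proof.
  rewrite <- dens_haz.
  pose proof (is_derive_primitive dens dens_continuous 0 t) as d.
  replace (- dens t) with (minus 0 (dens t))
    by (unfold minus, plus, opp; simpl; ring).
  apply (@is_derive_minus R_AbsRing R_NormedModule); [|exact d].
  apply (@is_derive_const R_AbsRing R_NormedModule).
Qed.

Lemma surv_continuous (t : R) : continuous surv t.
Proof. eapply derivable_continuous, surv_derive. Qed.

Lemma haz_hazard (t : R) : 0 <= t -> haz t = hazard M t.
Proof. now intros t0; unfold haz, hazard; rewrite surv_G, dens_g. Qed.

Lemma haz_continuous (t : R) : continuous haz t.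
Proof.
  unfold haz, Rdiv.
  apply (@continuous_mult R_UniformSpace R_AbsRing); [apply dens_continuous|].
  apply continuous_Rinv_comp; [apply surv_continuous|].
  pose proof (surv_pos t); lra.
Qed.

Lemma haz_decr (s t : R) : 0 <= s -> s < t -> haz t < haz s.
Proof. intros s0 st; rewrite !haz_hazard by lra; auto. Qed.

Lemma haz_decr_le (s t : R) : 0 <= s -> s <= t -> haz t <= haz s.
Proof.
  intros s0 [st| ->]; [|lra]; apply Rlt_le, haz_decr; auto.
Qed.

(** A nonnegative function that keeps strictly decreasing cannot reach 0. *)
Lemma haz_pos (t : R) : 0 <= t -> 0 < haz t.
Proof.
  intros t0; apply Rle_lt_trans with (haz (t + 1)); [|apply haz_decr; lra].
  apply Rmult_le_pos; [apply dens_ge0|].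
  apply Rlt_le, Rinv_0_lt_compat, surv_pos.
Qed.

Lemma haz_inj (s t : R) : 0 <= s -> 0 <= t -> haz s = haz t -> s = t.
Proof.
  intros s0 t0 e; destruct (Rtotal_order s t) as [h|[h|h]]; auto;
    apply haz_decr in h; lra.
Qed.

(** [Lim] at [p_infty] is the sequential limit along [INR n], so a bound on all large integers is
    enough. *)
Lemma hazard_infty_le (t : R) : 0 <= t -> Rbar_le (hazard_infty M) (haz t).
Proof.
  intros t0; rewrite <- (Lim_seq_const (haz t)).
  apply Lim_seq_le_loc.
  destruct (nfloor_ex t t0) as [n Hn]; exists (S n); intros m Hm.
  apply le_INR in Hm; rewrite S_INR in Hm; simpl.
  rewrite <- haz_hazard by apply pos_INR.
  apply haz_decr_le; lra.
Qed.

Lemma haz_below (c : R) :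
  Rbar_lt (hazard_infty M) c -> exists t, 0 <= t /\ haz t < c.
Proof.
  intros hc.
  destruct (Classical_Prop.classic (exists t, 0 <= t /\ haz t < c)) as [|no];
    auto.
  exfalso; apply (Rbar_lt_not_le _ _ hc).
  rewrite <- (Lim_seq_const c); apply Lim_seq_le_loc.
  exists O; intros n _; simpl.
  rewrite <- haz_hazard by apply pos_INR.
  destruct (Rle_lt_dec c (haz (INR n))); auto.
  exfalso; apply no; exists (INR n); split; auto using pos_INR.
Qed.

Lemma continuous_continuity (f : R -> R) :
  (forall x, continuous f x) -> continuity f.
Proof. intros cf x; apply continuity_pt_filterlim, cf. Qed.

(** (A1) places [phi_P] between the hazard at 0 and the hazard at some later time. The intermediate
    value theorem gives a solution and strict monotonicity makes it the one chosen by [iota]. *)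
Lemma tau_P_spec (vt : R) :
  assumption_A1 M vt -> 0 < tau_P M vt /\ haz (tau_P M vt) = phi_P M vt.
Proof.
  intros [h0 hinf].
  rewrite <- haz_hazard in h0 by lra.
  destruct (haz_below _ hinf) as [T [T0 hT]].
  destruct (IVT_gen haz 0 T (phi_P M vt)) as [t [t0 ht]].
  - apply continuous_continuity, haz_continuous.
  - rewrite Rmin_right, Rmax_left; lra.
  - rewrite Rmin_left, Rmax_right in t0 by lra.
    assert (e : tau_P M vt = t).
    { apply iota_eq.
      - rewrite <- haz_hazard; lra.
      - intros y [y0 hy]; rewrite <- haz_hazard in hy by lra.
        apply haz_inj; lra. }
    rewrite e; split; auto.
    destruct (proj1 t0) as [|<-]; lra.
Qed.

Lemma phi_P_lt (v w : R) : v < w < 1 -> phi_P M v < phi_P M w.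
Proof.
  intros [vw w1]; unfold phi_P.
  apply Rmult_lt_reg_r with (mu M * (1 - v) * (1 - w)).
  { repeat apply Rmult_lt_0_compat; lra. }
  field_simplify; try lra.
  assert (0 < rho M * (w - v)) by (apply Rmult_lt_0_compat; lra); nra.
Qed.

(** * The faking hazard [H_A], extended continuously to the line, and its cumulative integral *)

Definition fake_haz (vt s : R) : R :=
  (mu M * (1 - vt) * haz s - rho M * vt) / (vt - mu M).

Definition cum_fake (vt t : R) : R := RInt (fake_haz vt) 0 t.

Lemma fake_haz_continuous (vt s : R) : continuous (fake_haz vt) s.
Proof.
  unfold fake_haz; continuous_compound; apply haz_continuous.
Qed.

Lemma RInt_fake_haz (vt s t : R) :
  RInt (fake_haz vt) s t = cum_fake vt t - cum_fake vt s.
Proof.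
  unfold cum_fake.
  rewrite (RInt_split _ (fake_haz_continuous vt) s 0 t); lra.
Qed.

Lemma RInt_H_A (vt s t : R) :
  0 <= s -> 0 <= t -> RInt (H_A M vt) s t = cum_fake vt t - cum_fake vt s.
Proof.
  intros s0 t0; rewrite <- RInt_fake_haz.
  apply (@RInt_ext R_CompleteNormedModule); intros x [hx _].
  unfold fake_haz, H_A; rewrite haz_hazard; auto.
  apply Rlt_le, Rle_lt_trans with (2 := hx); apply Rmin_glb; lra.
Qed.

Lemma cum_fake_derive (vt t : R) :
  is_derive (cum_fake vt) t (fake_haz vt t).
Proof. apply is_derive_primitive, fake_haz_continuous. Qed.

Lemma cum_fake_continuous (vt t : R) : continuous (cum_fake vt) t.
Proof. eapply derivable_continuous, cum_fake_derive. Qed.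

Lemma cum_fake0 (vt : R) : cum_fake vt 0 = 0.
Proof. apply (@RInt_point R_CompleteNormedModule). Qed.

(** * Discounted survival, and payoffs as integrals of marginal values of waiting *)

Definition disc (t : R) : R := exp (- (rho M * t)) * surv t.

Lemma disc_pos (t : R) : 0 < disc t.
Proof. apply Rmult_lt_0_compat; [apply exp_pos|apply surv_pos]. Qed.

Lemma disc_derive (t : R) :
  is_derive disc t (- (rho M + haz t) * disc t).
Proof.
  replace (- (rho M + haz t) * disc t)
    with (- rho M * exp (- (rho M * t)) * surv t
          + exp (- (rho M * t)) * - (haz t * surv t))
    by (unfold disc; ring).
  apply (@is_derive_mult R_AbsRing (fun t => exp (- (rho M * t))) surv).
  - auto_derive; auto; ring.
  - apply surv_derive.
  - intros; apply Rmult_comm.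
Qed.

Lemma disc_continuous (t : R) : continuous disc t.
Proof. eapply derivable_continuous, disc_derive. Qed.

(** A delay of at least [d] costs the discount factor [exp (- (rho M * d))], and survival can only
    fall further. *)
Lemma disc_le (d s t : R) :
  0 <= d -> s + d <= t -> disc t <= exp (- (rho M * d)) * disc s.
Proof.
  intros d0 st; unfold disc; rewrite <- Rmult_assoc, <- exp_plus.
  apply Rmult_le_compat.
  - apply Rlt_le, exp_pos.
  - apply Rlt_le, surv_pos.
  - assert (0 <= rho M * (t - s - d)) by (apply Rmult_le_pos; lra).
    destruct (Req_dec (rho M * t) (rho M * d + rho M * s)) as [e|];
      [right; f_equal; lra|].
    apply Rlt_le, exp_increasing; nra.
  - unfold surv; rewrite (RInt_split _ dens_continuous s 0 t).
    enough (0 <= RInt dens s t) by lra.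
    apply RInt_ge_0; [lra|apply ex_RInt_cont, dens_continuous|].
    intros; apply dens_ge0.
Qed.

Lemma disc_decr (s t : R) : s <= t -> disc t <= disc s.
Proof.
  intros st; apply Rle_trans with (1 := disc_le 0 s t ltac:(lra) ltac:(lra)).
  rewrite Rmult_0_r, Ropp_0, exp_0; lra.
Qed.

(** Differentiate in [t]: [disc] decays at rate [rho M + haz] and [S] at rate [H], so the loss in
    the terminal value [disc t * S t * theta] combines with the flow from news. Taking [S = 1] and
    [H = 0] gives the first-best payoff; the faking survival and its hazard give the payoff once
    faking has begun. *)
Lemma payoff_by_parts (theta : R) (S H : R -> R) (a t : R) :
  (forall s, is_derive S s (- (H s * S s))) ->
  (forall s, continuous H s) ->
  RInt (fun s => exp (- (rho M * s)) *
          ((mu M + (1 - mu M) * theta) * dens s * S s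
           + mu M * (H s * S s) * surv s)) a t
  + disc t * S t * theta
  = disc a * S a * theta
    + RInt (fun s => disc s * S s *
        (mu M * (1 - theta) * haz s - rho M * theta - (theta - mu M) * H s)) a t.
Proof.
  intros dS cH.
  assert (cS : forall s, continuous S s)
    by (intros s; eapply derivable_continuous, dS).
  set (psi := fun s => exp (- (rho M * s)) * _).
  set (chi := fun s => disc s * S s * _).
  assert (cpsi : forall s, continuous psi s).
  { intros s; unfold psi; continuous_compound;
      [apply dens_continuous|apply surv_continuous]. }
  assert (cchi : forall s, continuous chi s).
  { intros s; unfold chi; continuous_compound;
      [apply disc_continuous|apply haz_continuous]. }
  assert (dchi : forall s, is_derive
            (fun x => RInt psi a x + theta * (disc x * S x)) s (chi s)).
  { intros s.
    replace (chi s) with (psi s + theta *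
      (- (rho M + haz s) * disc s * S s + disc s * - (H s * S s)))
      by (unfold psi, chi, disc; rewrite dens_haz; ring).
    apply (@is_derive_plus R_AbsRing R_NormedModule).
    - now apply is_derive_primitive.
    - apply is_derive_scal, (@is_derive_mult R_AbsRing disc S).
      + apply disc_derive.
      + apply dS.
      + intros; apply Rmult_comm. }
  pose proof (RInt_primitive chi cchi _ a t dchi) as e.
  cbv beta in e; rewrite (@RInt_point R_CompleteNormedModule) in e.
  change (@zero _) with 0 in e; lra.
Qed.

(** Derivative of the first-best payoff in the stopping time. It equals [(theta - mu M) * disc s *
    fake_haz theta s], which ties the faking hazard to the value of waiting. *)
Definition flow (theta s : R) : R :=
  disc s * (mu M * (1 - theta) * haz s - rho M * theta).

Lemma flow_continuous (theta s : R) : continuous (flow theta) s.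
Proof.
  unfold flow; continuous_compound;
    [apply disc_continuous|apply haz_continuous].
Qed.

Lemma first_best_flow (theta t : R) :
  0 <= t -> first_best_payoff M theta t = theta + RInt (flow theta) 0 t.
Proof.
  intros t0; pose proof (payoff_by_parts theta (fun _ => 1) (fun _ => 0) 0 t) as e.
  assert (d0 : disc 0 = 1).
  { unfold disc, surv; rewrite (@RInt_point R_CompleteNormedModule), Rmult_0_r.
    rewrite Ropp_0, exp_0; change (@zero _) with 0; ring. }
  rewrite d0 in e.
  replace (RInt (flow theta) 0 t) with (RInt (fun s => disc s * 1 *
    (mu M * (1 - theta) * haz s - rho M * theta - (theta - mu M) * 0)) 0 t)
    by (apply (@RInt_ext R_CompleteNormedModule); intros; unfold flow; simpl; ring).
  rewrite !Rmult_1_l in e; rewrite <- e.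
  - unfold first_best_payoff, disc; rewrite <- surv_G by lra; f_equal; [|ring].
    apply (@RInt_ext R_CompleteNormedModule); intros s.
    rewrite Rmin_left by lra; intros [hs _]; rewrite dens_g; [simpl; ring|lra].
  - intros s.
    replace (- (0 * 1)) with 0 by ring.
    apply (@is_derive_const R_AbsRing R_NormedModule).
  - intros; apply continuous_const.
Qed.

(** * Equilibrium faking for a single safe payoff *)

Section SafePayoff.

Context (vt : R) (hvt : mu M < vt < 1) (A1 : assumption_A1 M vt).

(** This form exposes the sign: the coefficient is positive and the decreasing hazard crosses
    [phi_P] at [tau_P]. *)
Lemma fake_haz_phi (s : R) :
  fake_haz vt s = mu M * (1 - vt) / (vt - mu M) * (haz s - phi_P M vt).
Proof. unfold fake_haz, phi_P; field; lra. Qed.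

Lemma fake_coef_pos : 0 < mu M * (1 - vt) / (vt - mu M).
Proof.
  apply Rmult_lt_0_compat; [|apply Rinv_0_lt_compat; lra].
  apply Rmult_lt_0_compat; lra.
Qed.

Lemma fake_haz_pos (s : R) : 0 <= s < tau_P M vt -> 0 < fake_haz vt s.
Proof.
  intros hs; rewrite fake_haz_phi.
  apply Rmult_lt_0_compat; [apply fake_coef_pos|].
  destruct (tau_P_spec vt A1) as [_ <-].
  enough (haz (tau_P M vt) < haz s) by lra; apply haz_decr; lra.
Qed.

Lemma fake_haz_neg (s : R) : tau_P M vt <= s -> fake_haz vt s <= 0.
Proof.
  intros hs; rewrite fake_haz_phi.
  pose proof fake_coef_pos.
  destruct (tau_P_spec vt A1) as [p0 <-].
  enough (haz s <= haz (tau_P M vt)) by nra; apply haz_decr_le; lra.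
Qed.

Lemma fake_haz_tau_P : fake_haz vt (tau_P M vt) = 0.
Proof.
  rewrite fake_haz_phi; destruct (tau_P_spec vt A1) as [_ ->]; ring.
Qed.

Lemma cum_fake_lt (s t : R) :
  0 <= s -> s < t -> t <= tau_P M vt -> cum_fake vt s < cum_fake vt t.
Proof.
  intros s0 st tp; apply Rlt_0_minus; rewrite <- RInt_fake_haz.
  apply RInt_gt_0; auto.
  - intros; apply fake_haz_pos; lra.
  - intros; apply fake_haz_continuous.
Qed.

(** The cumulative faking hazard that leaves survival [1 - sigma_man M], hence the total to be spent
    between [tau_M] and [tau_P]. *)
Definition cum_sigma : R := - ln (1 - sigma_man M).

Lemma exp_cum_sigma : exp (- cum_sigma) = 1 - sigma_man M.
Proof. unfold cum_sigma; rewrite Ropp_involutive, exp_ln; lra. Qed.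

Lemma cum_sigma_pos : 0 < cum_sigma.
Proof.
  pose proof exp_cum_sigma as e; destruct (Rle_lt_dec cum_sigma 0) as [h|]; auto.
  pose proof (exp_ineq1_le (- cum_sigma)); lra.
Qed.

Lemma sigma_bar_iff :
  sigma_man M < sigma_bar M vt <-> cum_sigma < cum_fake vt (tau_P M vt).
Proof.
  destruct (tau_P_spec vt A1) as [p0 _].
  unfold sigma_bar; rewrite RInt_H_A, cum_fake0, Rminus_0_r by lra.
  pose proof exp_cum_sigma; split; intros h.
  - apply Ropp_lt_cancel, exp_lt_inv; lra.
  - apply Ropp_lt_contravar, exp_increasing in h; lra.
Qed.

(** The bound [sigma_bar] makes [cum_fake vt (tau_P M vt) - cum_sigma] positive, so the increasing
    [cum_fake] takes this value exactly once strictly between 0 and [tau_P]. *)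
Lemma tau_M_spec :
  sigma_man M < sigma_bar M vt ->
  0 < tau_M M vt < tau_P M vt /\
  cum_fake vt (tau_P M vt) - cum_fake vt (tau_M M vt) = cum_sigma.
Proof.
  rewrite sigma_bar_iff; intros hL.
  destruct (tau_P_spec vt A1) as [p0 _].
  pose proof cum_sigma_pos as L0; pose proof exp_cum_sigma as eL.
  destruct (IVT_gen (cum_fake vt) 0 (tau_P M vt)
              (cum_fake vt (tau_P M vt) - cum_sigma)) as [t [ht e]].
  - apply continuous_continuity, cum_fake_continuous.
  - rewrite cum_fake0, Rmin_left, Rmax_right; lra.
  - rewrite Rmin_left, Rmax_right in ht by lra.
    assert (t <> 0) by (intros ->; rewrite cum_fake0 in e; lra).
    assert (t <> tau_P M vt) by (intros ->; lra).
    assert (et : tau_M M vt = t).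
    { apply iota_eq.
      - split; [lra|]; rewrite RInt_H_A by lra.
        replace (cum_fake vt (tau_P M vt) - cum_fake vt t) with cum_sigma by lra.
        lra.
      - intros y [hy ey]; rewrite RInt_H_A in ey by lra.
        assert (ly : - (cum_fake vt (tau_P M vt) - cum_fake vt y) = - cum_sigma)
          by (apply exp_inv; lra).
        destruct (Rtotal_order y t) as [h|[h|h]]; auto;
          apply cum_fake_lt in h; lra. }
    rewrite et; lra.
Qed.

Context (hsb : sigma_man M < sigma_bar M vt).

(** Equals [1 - sigma_man M * F_A M vt t] on the faking interval; keeping the same formula outside
    makes it differentiable everywhere. *)
Definition fake_surv (t : R) : R :=
  exp (- (cum_fake vt t - cum_fake vt (tau_M M vt))).

Lemma fake_surv_pos (t : R) : 0 < fake_surv t.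
Proof. apply exp_pos. Qed.

Lemma fake_surv_tau_M : fake_surv (tau_M M vt) = 1.
Proof. unfold fake_surv; rewrite Rminus_diag, Ropp_0; apply exp_0. Qed.

Lemma fake_surv_derive (t : R) :
  is_derive fake_surv t (- (fake_haz vt t * fake_surv t)).
Proof. apply derive_survival, cum_fake_derive. Qed.

Lemma fake_surv_continuous (t : R) : continuous fake_surv t.
Proof. eapply derivable_continuous, fake_surv_derive. Qed.

Lemma fake_surv_le1 (t : R) :
  tau_M M vt <= t <= tau_P M vt -> fake_surv t <= 1.
Proof.
  destruct (tau_M_spec hsb) as [hM _].
  intros [[lt|<-] ht]; [|rewrite fake_surv_tau_M; lra].
  rewrite <- exp_0; apply Rlt_le, exp_increasing.
  enough (cum_fake vt (tau_M M vt) < cum_fake vt t) by lra.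
  apply cum_fake_lt; lra.
Qed.

Lemma F_A_before (t : R) : t < tau_M M vt -> F_A M vt t = 0.
Proof. intros ht; unfold F_A; destruct Rlt_dec; lra. Qed.

Lemma F_A_during (t : R) :
  tau_M M vt <= t <= tau_P M vt -> sigma_man M * F_A M vt t = 1 - fake_surv t.
Proof.
  destruct (tau_M_spec hsb) as [hM _].
  intros ht; unfold F_A; destruct Rlt_dec; [lra|].
  destruct Rle_dec; [|lra].
  rewrite RInt_H_A by lra; unfold fake_surv; field; lra.
Qed.

Lemma F_A_after (t : R) : tau_P M vt <= t -> F_A M vt t = 1.
Proof.
  destruct (tau_M_spec hsb) as [hM e].
  intros [lt|<-].
  - unfold F_A; destruct Rlt_dec; [lra|]; destruct Rle_dec; lra.
  (* At [tau_P] itself the middle clause of [F_A] applies; it also gives 1, because the hazard spent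
     by then is [cum_sigma]. *)
  - apply Rmult_eq_reg_l with (sigma_man M); [|lra].
    rewrite F_A_during by lra; unfold fake_surv; rewrite e, exp_cum_sigma; ring.
Qed.

Lemma f_A_before (t : R) : t < tau_M M vt -> f_A M vt t = 0.
Proof.
  intros ht; apply right_derivative_eq with (phi := fun _ => 0).
  - apply (@is_derive_const R_AbsRing R_NormedModule).
  - now apply F_A_before.
  - assert (d0 : 0 < tau_M M vt - t) by lra.
    exists (mkposreal _ d0); simpl; intros s hs; apply F_A_before; lra.
Qed.

Lemma f_A_during (t : R) :
  tau_M M vt <= t < tau_P M vt ->
  sigma_man M * f_A M vt t = fake_haz vt t * fake_surv t.
Proof.
  intros ht.
  assert (F : forall s, tau_M M vt <= s <= tau_P M vt ->
                F_A M vt s = / sigma_man M * (1 - fake_surv s)).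
  { intros s hs; rewrite <- F_A_during by lra; field; lra. }
  replace (fake_haz vt t * fake_surv t)
    with (sigma_man M * (/ sigma_man M * (0 - - (fake_haz vt t * fake_surv t))))
    by (field; lra).
  f_equal.
  apply right_derivative_eq
    with (phi := fun s => / sigma_man M * (1 - fake_surv s)).
  - apply is_derive_scal, (@is_derive_minus R_AbsRing R_NormedModule).
    + apply (@is_derive_const R_AbsRing R_NormedModule).
    + apply fake_surv_derive.
  - apply F; lra.
  - assert (d0 : 0 < tau_P M vt - t) by lra.
    exists (mkposreal _ d0); simpl; intros s hs; apply F; lra.
Qed.

Lemma f_A_tau_P : f_A M vt (tau_P M vt) = 0.
Proof.
  apply right_derivative_eq with (phi := fun _ => 1).
  - apply (@is_derive_const R_AbsRing R_NormedModule).
  - apply F_A_after; lra.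
  - exists (mkposreal _ Rlt_0_1); simpl; intros s hs; apply F_A_after; lra.
Qed.

(** * The stopping time of the decision maker *)

Definition stop_haz (t : R) : R :=
  (beta M * (1 - mu M) * haz t - rho M * mu M) / (mu M - beta M).

Definition stop_surv (t : R) : R :=
  exp (- (RInt stop_haz 0 t - RInt stop_haz 0 (tau_M M vt))).

Lemma stop_haz_continuous (t : R) : continuous stop_haz t.
Proof. unfold stop_haz; continuous_compound; apply haz_continuous. Qed.

Lemma stop_surv_tau_M : stop_surv (tau_M M vt) = 1.
Proof. unfold stop_surv; rewrite Rminus_diag, Ropp_0; apply exp_0. Qed.

Lemma stop_surv_derive (t : R) :
  is_derive stop_surv t (- (stop_haz t * stop_surv t)).
Proof.
  apply derive_survival with (Lam := fun t => RInt stop_haz 0 t).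
  apply is_derive_primitive, stop_haz_continuous.
Qed.

Lemma stop_surv_continuous (t : R) : continuous stop_surv t.
Proof. eapply derivable_continuous, stop_surv_derive. Qed.

Lemma F_P_during (t : R) :
  tau_M M vt <= t < tau_P M vt -> F_P M vt t = 1 - stop_surv t.
Proof.
  destruct (tau_M_spec hsb) as [hM _].
  intros ht; unfold F_P; do 2 (destruct Rlt_dec; try lra).
  unfold stop_surv; do 3 f_equal.
  rewrite (RInt_split _ stop_haz_continuous (tau_M M vt) 0 t).
  rewrite Rplus_minus_l.
  apply (@RInt_ext R_CompleteNormedModule); intros x.
  rewrite Rmin_left by lra; intros [hx _].
  unfold stop_haz; rewrite haz_hazard; lra.
Qed.

Lemma f_P_during (t : R) :
  tau_M M vt <= t < tau_P M vt -> f_P M vt t = stop_haz t * stop_surv t.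
Proof.
  intros ht.
  replace (stop_haz t * stop_surv t)
    with (0 - - (stop_haz t * stop_surv t)) by ring.
  apply right_derivative_eq with (phi := fun s => 1 - stop_surv s).
  - apply (@is_derive_minus R_AbsRing R_NormedModule).
    + apply (@is_derive_const R_AbsRing R_NormedModule).
    + apply stop_surv_derive.
  - apply F_P_during; lra.
  - assert (d0 : 0 < tau_P M vt - t) by lra.
    exists (mkposreal _ d0); simpl; intros s hs; apply F_P_during; lra.
Qed.

(** Hence the atom at [tau_P] has mass [stop_surv (tau_P M vt)]. *)
Lemma F_P_left_limit :
  left_limit (F_P M vt) (tau_P M vt) = 1 - stop_surv (tau_P M vt).
Proof.
  apply left_limit_eq with (phi := fun s => 1 - stop_surv s).
  - continuous_compound; apply stop_surv_continuous.
  - destruct (tau_M_spec hsb) as [hM _].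
    assert (d0 : 0 < tau_P M vt - tau_M M vt) by lra.
    exists (mkposreal _ d0); simpl; intros s hs; apply F_P_during; lra.
Qed.

(** Up to [tau_P] the hazard is at least [phi_P], which (A2) puts above [phi_A], the level at which
    [stop_haz] changes sign. *)
Lemma stop_haz_ge0 (t : R) :
  assumption_A2 M vt -> 0 <= t <= tau_P M vt -> 0 <= stop_haz t.
Proof.
  intros A2 ht; destruct (tau_P_spec vt A1) as [_ e].
  pose proof (haz_decr_le t (tau_P M vt) (proj1 ht) (proj2 ht)) as hh.
  rewrite e in hh; red in A2; unfold phi_A in A2.
  apply Rmult_le_pos; [|apply Rlt_le, Rinv_0_lt_compat; lra].
  assert (b0 : 0 < beta M * (1 - mu M)) by (apply Rmult_lt_0_compat; lra).
  assert (rho M * mu M / (beta M * (1 - mu M)) < haz t) as hlt by lra.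
  apply Rmult_lt_compat_l with (1 := b0) in hlt.
  replace (beta M * (1 - mu M) * (rho M * mu M / (beta M * (1 - mu M))))
    with (rho M * mu M) in hlt by (field; lra).
  lra.
Qed.

Lemma fake_haz_ge0 (t : R) : 0 <= t <= tau_P M vt -> 0 <= fake_haz vt t.
Proof.
  intros [t0 [lt| ->]]; [apply Rlt_le, fake_haz_pos; lra|].
  rewrite fake_haz_tau_P; lra.
Qed.

(** * Beliefs after type-1 news *)

Lemma news_density_pos (t : R) :
  0 <= t -> 0 < g M t.
Proof.
  intros t0; rewrite <- dens_g, dens_haz by auto.
  apply Rmult_lt_0_compat; [now apply haz_pos|apply surv_pos].
Qed.

Lemma mu1_before (t : R) : 0 <= t < tau_M M vt -> mu1 M vt t = 1.
Proof.
  intros ht; unfold mu1; rewrite F_A_before, f_A_before by lra.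
  pose proof (news_density_pos t (proj1 ht)); field; lra.
Qed.

(** The right density of faking vanishes at [tau_P], while real news still has positive weight there
    because [sigma_man M < 1]. *)
Lemma mu1_tau_P : mu1 M vt (tau_P M vt) = 1.
Proof.
  destruct (tau_M_spec hsb) as [hM _].
  unfold mu1; rewrite F_A_after, f_A_tau_P by lra.
  assert (0 <= tau_P M vt) as p0 by lra.
  pose proof (news_density_pos _ p0); field; lra.
Qed.

Lemma w1_during_pos (t : R) :
  tau_M M vt <= t < tau_P M vt ->
  0 < w1 M vt t.
Proof.
  destruct (tau_M_spec hsb) as [hM _].
  intros ht; unfold w1; rewrite F_A_during, f_A_during by lra.
  assert (0 <= t < tau_P M vt) as ht' by lra.
  pose proof (fake_surv_pos t); pose proof (news_density_pos t (proj1 ht')).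
  pose proof (fake_haz_pos t ht'); specialize (hG1 t).
  set (lam := fake_haz vt t) in *; clearbody lam.
  apply Rplus_lt_0_compat; repeat apply Rmult_lt_0_compat; lra.
Qed.

(** Cross-multiplied, the claim reads [(theta - mu M) * fake_haz vt t <= mu M * (1 - theta) * haz
    t]; inserting the formula for [fake_haz] gives the hypothesis. The latter is strict at
    [vt = theta], so it survives small changes of [vt]. *)
Lemma mu1_during (theta t : R) :
  tau_M M vt <= t < tau_P M vt ->
  (theta - vt) * (mu M * (1 - mu M) * haz t) <= rho M * vt * (theta - mu M) ->
  theta <= mu1 M vt t.
Proof.
  destruct (tau_M_spec hsb) as [hM _].
  intros ht hle; pose proof (w1_during_pos t ht) as w.
  unfold mu1; apply Rmult_le_reg_r with (1 := w).
  fold (w1 M vt t); unfold Rdiv.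
  rewrite Rmult_assoc, Rinv_l, Rmult_1_r by lra.
  unfold w1; rewrite Rmult_assoc with (r1 := mu M) (r2 := sigma_man M).
  rewrite F_A_during, f_A_during, <- surv_G, <- dens_g, dens_haz by lra.
  set (Q := surv t); set (S := fake_surv t); set (H := fake_haz vt t).
  enough (0 <= Q * S * (mu M * haz t * (1 - theta) - (theta - mu M) * H)) by nra.
  apply Rmult_le_pos.
  - apply Rlt_le, Rmult_lt_0_compat; [apply surv_pos|apply fake_surv_pos].
  - apply Rmult_le_reg_r with (vt - mu M); [lra|].
    rewrite Rmult_0_l, Rmult_minus_distr_r, Rmult_assoc with (r2 := H).
    replace (H * (vt - mu M)) with (mu M * (1 - vt) * haz t - rho M * vt)
      by (unfold H, fake_haz; field; lra).
    nra.
Qed.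

(** * The principal's payoff from delegation *)

Definition news_integrand (theta s : R) : R :=
  exp (- (rho M * s)) * (w0 M vt s * theta + w1 M vt s * mu1 M vt s).

Lemma news_integrand_before (theta s : R) :
  0 <= s < tau_M M vt ->
  news_integrand theta s
  = exp (- (rho M * s)) * g M s * (mu M + (1 - mu M) * theta).
Proof.
  intros hs; unfold news_integrand, w0, w1.
  rewrite mu1_before, F_A_before, f_A_before by lra; ring.
Qed.

Lemma news_integrand_during (theta s : R) :
  tau_M M vt <= s < tau_P M vt ->
  news_integrand theta s
  = exp (- (rho M * s)) *
      ((mu M + (1 - mu M) * theta) * dens s * fake_surv s
       + mu M * (fake_haz vt s * fake_surv s) * surv s).
Proof.
  destruct (tau_M_spec hsb) as [hM _].
  intros hs; unfold news_integrand; pose proof (w1_during_pos s hs) as w.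
  unfold mu1; fold (w1 M vt s).
  (* The denominator of [mu1] is [w1], so it cancels in the integrand. *)
  replace (w1 M vt s * (_ / w1 M vt s))
    with (mu M * g M s * (1 - sigma_man M * F_A M vt s)
          + mu M * (sigma_man M * f_A M vt s) * (1 - G M s)) by (field; lra).
  unfold w0; rewrite F_A_during, f_A_during, surv_G, dens_g by lra; ring.
Qed.

(** Before [tau_M] nothing is faked, so type-1 news is fully trusted. *)
Lemma u_P_tau_M (theta : R) :
  u_P M (tau_M M vt) vt theta = first_best_payoff M theta (tau_M M vt).
Proof.
  destruct (tau_M_spec hsb) as [hM _].
  unfold u_P, first_best_payoff, W_phi; rewrite F_A_during by lra.
  rewrite fake_surv_tau_M; f_equal; [|ring].
  apply (@RInt_ext R_CompleteNormedModule); intros s.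
  rewrite Rmin_left, Rmax_right by lra; intros hs.
  apply news_integrand_before; lra.
Qed.

(* The derivative of [u_P] in the stopping time. *)
Definition post_flow (theta s : R) : R :=
  disc s * fake_surv s *
    (mu M * (1 - theta) * haz s - rho M * theta - (theta - mu M) * fake_haz vt s).

Lemma post_flow_continuous (theta s : R) : continuous (post_flow theta) s.
Proof.
  unfold post_flow; continuous_compound;
    [apply disc_continuous|apply fake_surv_continuous|apply haz_continuous
    |apply fake_haz_continuous].
Qed.

Lemma ex_RInt_news_before (theta : R) :
  ex_RInt (news_integrand theta) 0 (tau_M M vt).
Proof.
  destruct (tau_M_spec hsb) as [hM _].
  apply ex_RInt_ext with
    (fun s => exp (- (rho M * s)) * dens s * (mu M + (1 - mu M) * theta)).
  - intros s; rewrite Rmin_left, Rmax_right by lra; intros hs.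
    rewrite news_integrand_before, dens_g by lra; auto.
  - apply ex_RInt_cont; intros s; continuous_compound; apply dens_continuous.
Qed.

Lemma u_P_during (theta t : R) :
  tau_M M vt <= t <= tau_P M vt ->
  u_P M t vt theta = first_best_payoff M theta (tau_M M vt)
                     + RInt (post_flow theta) (tau_M M vt) t.
Proof.
  destruct (tau_M_spec hsb) as [hM _]; intros ht.
  rewrite <- u_P_tau_M.
  pose proof (payoff_by_parts theta fake_surv (fake_haz vt) (tau_M M vt) t
                fake_surv_derive (fake_haz_continuous vt)) as e.
  fold (post_flow theta) in e.
  set (psi := fun s => exp (- (rho M * s)) * _) in e.
  assert (cpsi : forall s, continuous psi s).
  { intros s; unfold psi; continuous_compound;
      try apply dens_continuous; try apply surv_continuous;
      try apply fake_surv_continuous; apply fake_haz_continuous. }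
  assert (ext : forall s, Rmin (tau_M M vt) t < s < Rmax (tau_M M vt) t ->
                  psi s = news_integrand theta s).
  { intros s; rewrite Rmin_left, Rmax_right by lra; intros hs.
    symmetry; apply news_integrand_during; lra. }
  rewrite (@RInt_ext R_CompleteNormedModule _ _ _ _ ext) in e.
  unfold u_P; fold (news_integrand theta).
  rewrite <- (@RInt_Chasles R_CompleteNormedModule (news_integrand theta)
                0 (tau_M M vt) t).
  - unfold W_phi; rewrite !F_A_during, <- !surv_G by lra.
    unfold disc in e; change plus with Rplus.
    replace (1 - (1 - fake_surv t)) with (fake_surv t) by ring.
    replace (1 - (1 - fake_surv (tau_M M vt)))
      with (fake_surv (tau_M M vt)) by ring.
    lra.
  - apply ex_RInt_news_before.
  - apply (@ex_RInt_ext R_NormedModule _ _ _ _ ext), ex_RInt_cont, cpsi.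
Qed.

Lemma stop_prob_total :
  RInt (fun s => stop_haz s * stop_surv s) (tau_M M vt) (tau_P M vt)
  + stop_surv (tau_P M vt) = 1.
Proof.
  rewrite RInt_primitive with (F := fun s => - stop_surv s).
  - rewrite stop_surv_tau_M; lra.
  - intros s; continuous_compound;
      [apply stop_haz_continuous|apply stop_surv_continuous].
  - intros s; rewrite <- (Ropp_involutive (stop_haz s * stop_surv s)).
    apply (@is_derive_opp R_AbsRing R_NormedModule), stop_surv_derive.
Qed.

(** Replaces the right derivative and the left limit by expressions continuous on the whole line. *)
Lemma delegation_payoff_stop (theta : R) :
  delegation_payoff M vt theta
  = RInt (fun s => stop_haz s * stop_surv s *
            (first_best_payoff M theta (tau_M M vt)
             + RInt (post_flow theta) (tau_M M vt) s))
      (tau_M M vt) (tau_P M vt)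
    + stop_surv (tau_P M vt) * u_P M (tau_P M vt) vt theta.
Proof.
  destruct (tau_M_spec hsb) as [hM _].
  unfold delegation_payoff; rewrite F_P_left_limit; f_equal; [|ring].
  apply (@RInt_ext R_CompleteNormedModule); intros s.
  rewrite Rmin_left, Rmax_right by lra; intros hs.
  rewrite f_P_during, u_P_during by lra; reflexivity.
Qed.

(* [u_P] is nonincreasing in the stopping time after [tau_M], so stopping
   earlier than [tau_P] can only help. *)
Lemma delegation_payoff_ge (theta : R) :
  assumption_A2 M vt ->
  (forall s, tau_M M vt <= s <= tau_P M vt -> post_flow theta s <= 0) ->
  u_P M (tau_P M vt) vt theta <= delegation_payoff M vt theta.
Proof.
  intros A2 le0; destruct (tau_M_spec hsb) as [hM _].
  rewrite delegation_payoff_stop.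
  set (v := u_P M (tau_P M vt) vt theta).
  assert (c : forall s, continuous (fun s => stop_haz s * stop_surv s) s).
  { intros s; continuous_compound;
      [apply stop_haz_continuous|apply stop_surv_continuous]. }
  apply Rle_trans with (RInt (fun s => stop_haz s * stop_surv s * v)
                (tau_M M vt) (tau_P M vt) + stop_surv (tau_P M vt) * v).
  (* The constant [v] is its own average over stopping times, as density and atom have total mass
     1. *)
  { right; rewrite (@RInt_ext R_CompleteNormedModule _
      (fun s => scal v (stop_haz s * stop_surv s)))
      by (intros; apply Rmult_comm).
    rewrite (@RInt_scal R_CompleteNormedModule) by now apply ex_RInt_cont.
    change scal with Rmult.
    rewrite <- (Rmult_1_r v) at 1; rewrite <- stop_prob_total; ring. }
  apply Rplus_le_compat_r, RInt_le; [lra| | |].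
  - apply ex_RInt_cont; intros s; apply continuous_Rmult;
      [apply c|apply continuous_Rconst].
  - apply ex_RInt_cont; intros s.
    apply continuous_Rmult; [apply c|].
    apply continuous_Rplus; [apply continuous_Rconst|].
    eapply derivable_continuous, is_derive_primitive, post_flow_continuous.
  - intros s hs; apply Rmult_le_compat_l.
    + apply Rmult_le_pos; [apply stop_haz_ge0; auto; lra|apply Rlt_le, exp_pos].
    + unfold v; rewrite u_P_during by lra; apply Rplus_le_compat_l.
      rewrite (RInt_split _ (post_flow_continuous theta) s _ (tau_P M vt)).
      enough (RInt (post_flow theta) s (tau_P M vt) <= 0 * (tau_P M vt - s))
        by lra.
      apply RInt_le_const; [apply post_flow_continuous|lra|].
      intros x hx; apply le0; lra.
Qed.

(** The faking hazard for [vt] is the one that makes a decision maker with this safe payoff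
    indifferent: [post_flow vt] vanishes, so every stopping time in the support yields the payoff of
    stopping at [tau_M]. *)
Lemma delegation_payoff_self :
  delegation_payoff M vt vt = first_best_payoff M vt (tau_M M vt).
Proof.
  destruct (tau_M_spec hsb) as [hM _].
  assert (z : forall a b, RInt (post_flow vt) a b = 0).
  { intros a b; rewrite RInt_primitive with (F := fun _ => 0).
    - apply Rminus_diag.
    - apply post_flow_continuous.
    - intros s; replace (post_flow vt s) with 0
        by (unfold post_flow, fake_haz; field; lra).
      apply (@is_derive_const R_AbsRing R_NormedModule). }
  rewrite delegation_payoff_stop, u_P_during, z by lra.
  set (v := first_best_payoff _ _ _).
  rewrite (@RInt_ext R_CompleteNormedModule _
    (fun s => scal v (stop_haz s * stop_surv s))).
  - rewrite (@RInt_scal R_CompleteNormedModule).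
    + change scal with Rmult; pose proof stop_prob_total as e.
      transitivity (v * 1); [rewrite <- e|]; ring.
    + apply ex_RInt_cont; intros s; continuous_compound;
        [apply stop_haz_continuous|apply stop_surv_continuous].
  - intros s _; rewrite z, Rplus_0_r; apply Rmult_comm.
Qed.

End SafePayoff.

(** * Comparison of the equilibria for two safe payoffs *)

Definition faking_cost (s : R) : R := mu M * ((1 - mu M) * haz s - rho M).

Lemma faking_cost_continuous (s : R) : continuous faking_cost s.
Proof. unfold faking_cost; continuous_compound; apply haz_continuous. Qed.

Lemma faking_cost_decr (s t : R) :
  0 <= s -> s <= t -> faking_cost t <= faking_cost s.
Proof.
  intros s0 st; apply Rmult_le_compat_l; [lra|].
  pose proof (haz_decr_le s t s0 st); nra.
Qed.

Section TwoSafePayoffs.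

Context (theta thetaI : R)
  (hI : mu M < thetaI < theta) (htheta : theta < 1)
  (A1 : assumption_A1 M theta) (A1I : assumption_A1 M thetaI)
  (hsb : sigma_man M < sigma_bar M theta).

Local Notation a := (tau_M M theta).
Local Notation p := (tau_P M theta).
Local Notation b := (tau_M M thetaI).
Local Notation c := (tau_P M thetaI).

(** [tilt] and [faking_cost] are the [d] and [k] of the opening outline: their product is the rise
    in the faking hazard when the safe payoff falls to [thetaI]. *)
Definition tilt : R := (theta - thetaI) / ((thetaI - mu M) * (theta - mu M)).

Lemma tilt_pos : 0 < tilt.
Proof.
  apply Rmult_lt_0_compat; [lra|].
  apply Rinv_0_lt_compat, Rmult_lt_0_compat; lra.
Qed.

Lemma fake_haz_tilt (s : R) :
  fake_haz thetaI s = fake_haz theta s + tilt * faking_cost s.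
Proof. unfold fake_haz, tilt, faking_cost; field; lra. Qed.

Lemma RInt_fake_haz_tilt (s t : R) :
  RInt (fake_haz thetaI) s t
  = RInt (fake_haz theta) s t + tilt * RInt faking_cost s t.
Proof.
  rewrite (RInt_primitive _ (fake_haz_continuous thetaI)
    (fun x => RInt (fake_haz theta) s x + tilt * RInt faking_cost s x)).
  - rewrite !(@RInt_point R_CompleteNormedModule).
    change (@zero _) with 0; lra.
  - intros x; rewrite fake_haz_tilt.
    apply (@is_derive_plus R_AbsRing R_NormedModule).
    + apply is_derive_primitive, fake_haz_continuous.
    + apply is_derive_scal, is_derive_primitive, faking_cost_continuous.
Qed.

(** A lower safe payoff lowers [phi_P], which the decreasing hazard reaches later. *)
Lemma tau_P_increases : p < c.
Proof.
  destruct (tau_P_spec theta A1) as [p0 hp].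
  destruct (tau_P_spec thetaI A1I) as [c0 hc].
  assert (phi_P M thetaI < phi_P M theta) by (apply phi_P_lt; lra).
  destruct (Rlt_le_dec p c) as [|cp]; auto.
  pose proof (haz_decr_le c p ltac:(lra) cp); lra.
Qed.

(** The smallest value is at [c], where the hazard is [phi_P M thetaI] and the cost becomes a
    positive multiple of [thetaI - mu M]. *)
Lemma faking_cost_pos (s : R) : 0 <= s <= c -> 0 < faking_cost s.
Proof.
  intros hs; apply Rlt_le_trans with (faking_cost c);
    [|apply faking_cost_decr; lra].
  destruct (tau_P_spec thetaI A1I) as [c0 hc].
  unfold faking_cost; rewrite hc; unfold phi_P.
  replace ((1 - mu M) * (rho M * thetaI / (mu M * (1 - thetaI))) - rho M)
    with (rho M * (thetaI - mu M) / (mu M * (1 - thetaI))) by (field; lra).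
  repeat apply Rmult_lt_0_compat; try lra.
  apply Rinv_0_lt_compat, Rmult_lt_0_compat; lra.
Qed.

Lemma RInt_faking_cost_pos (s t : R) :
  0 <= s -> s < t -> t <= c -> 0 < RInt faking_cost s t.
Proof.
  intros s0 st tc; apply RInt_gt_0; auto.
  - intros; apply faking_cost_pos; lra.
  - intros; apply faking_cost_continuous.
Qed.

Lemma RInt_fake_haz_ge0 (s t : R) :
  0 <= s -> s <= t -> t <= c -> 0 <= RInt (fake_haz thetaI) s t.
Proof.
  intros s0 st tc; apply RInt_ge_0; auto.
  - apply ex_RInt_cont, fake_haz_continuous.
  - intros; apply fake_haz_ge0; auto; lra.
Qed.

Lemma sigma_bar_lower : sigma_man M < sigma_bar M thetaI.
Proof.
  destruct (tau_P_spec theta A1) as [p0 hp]; pose proof tau_P_increases as pc.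
  apply (sigma_bar_iff thetaI A1I); apply (sigma_bar_iff theta A1) in hsb.
  unfold cum_fake; rewrite (RInt_split _ (fake_haz_continuous thetaI) p 0 c).
  rewrite RInt_fake_haz_tilt; fold (cum_fake theta p).
  pose proof (RInt_fake_haz_ge0 p c ltac:(lra) ltac:(lra) ltac:(lra)).
  pose proof (RInt_faking_cost_pos 0 p ltac:(lra) ltac:(lra) ltac:(lra)).
  pose proof tilt_pos.
  assert (0 < tilt * RInt faking_cost 0 p) by (apply Rmult_lt_0_compat; lra).
  lra.
Qed.

Lemma RInt_fake_haz_total :
  RInt (fake_haz theta) a p = cum_sigma /\
  RInt (fake_haz thetaI) b c = cum_sigma.
Proof.
  rewrite !RInt_fake_haz; split.
  - apply tau_M_spec; auto; lra.
  - apply tau_M_spec; auto using sigma_bar_lower; lra.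
Qed.

(** Otherwise [[b, c]] would contain [[a, p]], where the tilted hazard alone already exceeds
    [cum_sigma]. *)
Lemma tau_M_increases : a < b.
Proof.
  assert (ht : mu M < theta < 1) by lra.
  assert (hi : mu M < thetaI < 1) by lra.
  destruct (tau_M_spec theta ht A1 hsb) as [ha _].
  destruct (tau_M_spec thetaI hi A1I sigma_bar_lower) as [hb _].
  pose proof tau_P_increases as pc; destruct RInt_fake_haz_total as [Ta Tb].
  destruct (Rlt_le_dec a b) as [|ba]; auto; exfalso.
  rewrite (RInt_split _ (fake_haz_continuous thetaI) a) in Tb.
  rewrite (RInt_split _ (fake_haz_continuous thetaI) p a) in Tb.
  rewrite (RInt_fake_haz_tilt a p), Ta in Tb.
  pose proof (RInt_fake_haz_ge0 p c ltac:(lra) ltac:(lra) ltac:(lra)).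
  pose proof (RInt_fake_haz_ge0 b a ltac:(lra) ltac:(lra) ltac:(lra)).
  pose proof (RInt_faking_cost_pos a p ltac:(lra) ltac:(lra) ltac:(lra)).
  pose proof tilt_pos.
  assert (0 < tilt * RInt faking_cost a p) by (apply Rmult_lt_0_compat; lra).
  lra.
Qed.

(** If [b] were at least [m], the hazard over [[m, c]] would be at least [cum_sigma]. Since
    [fake_haz theta] is nonpositive after [p], that hazard is at most its untilted part on [[m, p]]
    plus a multiple of [tilt], which is small for [thetaI] near [theta]. *)
Lemma tau_M_upper (m : R) :
  a < m < p ->
  tilt * (faking_cost 0 * c) < cum_sigma - RInt (fake_haz theta) m p ->
  b < m.
Proof.
  intros hm h.
  assert (ht : mu M < theta < 1) by lra.
  assert (hi : mu M < thetaI < 1) by lra.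
  destruct (tau_M_spec theta ht A1 hsb) as [ha _].
  destruct (tau_M_spec thetaI hi A1I sigma_bar_lower) as [hb _].
  pose proof tau_P_increases as pc; destruct RInt_fake_haz_total as [Ta Tb].
  destruct (Rlt_le_dec b m) as [|mb]; auto; exfalso.
  pose proof (RInt_fake_haz_ge0 m b ltac:(lra) ltac:(lra) ltac:(lra)) as h1.
  pose proof (RInt_fake_haz_tilt m c) as h2.
  rewrite (RInt_split _ (fake_haz_continuous thetaI) b m c) in h2.
  rewrite (RInt_split _ (fake_haz_continuous theta) p m c) in h2.
  assert (RInt (fake_haz theta) p c <= 0 * (c - p)).
  { apply RInt_le_const; [apply fake_haz_continuous|lra|].
    intros x hx; apply fake_haz_neg; auto; lra. }
  assert (RInt faking_cost m c <= faking_cost 0 * (c - m)).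
  { apply RInt_le_const; [apply faking_cost_continuous|lra|].
    intros; apply faking_cost_decr; lra. }
  assert (0 < faking_cost 0) by (apply faking_cost_pos; lra).
  assert (tilt * RInt faking_cost m c <= tilt * (faking_cost 0 * c)).
  { apply Rmult_le_compat_l; [apply Rlt_le, tilt_pos|nra]. }
  lra.
Qed.

(** The bracket in [post_flow] vanishes for the untilted hazard, so only the tilt remains. *)
Lemma post_flow_tilt (s : R) :
  post_flow thetaI theta s
  = - ((theta - mu M) * tilt) * (disc s * fake_surv thetaI s * faking_cost s).
Proof.
  unfold post_flow; rewrite fake_haz_tilt; unfold fake_haz; field; lra.
Qed.

Lemma post_flow_le0 (s : R) : 0 <= s <= c -> post_flow thetaI theta s <= 0.
Proof.
  intros hs; rewrite post_flow_tilt.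
  assert (0 <= (theta - mu M) * tilt *
            (disc s * fake_surv thetaI s * faking_cost s)); [|lra].
  pose proof tilt_pos; pose proof (faking_cost_pos s hs).
  pose proof (disc_pos s); pose proof (fake_surv_pos thetaI s).
  apply Rmult_le_pos; [apply Rmult_le_pos; lra|].
  apply Rmult_le_pos; [apply Rmult_le_pos; lra|lra].
Qed.

Lemma RInt_post_flow_ge (s t q : R) :
  b <= s -> s <= t -> t <= c -> 0 <= q ->
  (forall x, s <= x <= t -> disc x <= q) ->
  - ((theta - mu M) * tilt * q * RInt faking_cost s t)
  <= RInt (post_flow thetaI theta) s t.
Proof.
  intros bs st tc q0 hq.
  assert (hi : mu M < thetaI < 1) by lra.
  destruct (tau_M_spec thetaI hi A1I sigma_bar_lower) as [hb _].
  rewrite <- Ropp_mult_distr_l_reverse, <- RInt_Rmult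
    by apply faking_cost_continuous.
  apply RInt_le; auto.
  - apply ex_RInt_cont; intros x; apply continuous_Rmult;
      [apply continuous_Rconst|apply faking_cost_continuous].
  - apply ex_RInt_cont, post_flow_continuous.
  - intros x hx; rewrite post_flow_tilt.
    pose proof tilt_pos as d0.
    assert (kx : 0 < faking_cost x) by (apply faking_cost_pos; lra).
    pose proof (disc_pos x) as D0; pose proof (fake_surv_pos thetaI x) as S0.
    assert (S1 : fake_surv thetaI x <= 1)
      by (apply fake_surv_le1; auto using sigma_bar_lower; lra).
    assert (Dq : disc x <= q) by (apply hq; lra).
    assert (DS : disc x * fake_surv thetaI x <= q * 1)
      by (apply Rmult_le_compat; lra).
    rewrite !Ropp_mult_distr_l_reverse; apply Ropp_le_contravar.
    rewrite !Rmult_assoc; do 2 (apply Rmult_le_compat_l; [lra|]).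
    rewrite <- Rmult_assoc; apply Rmult_le_compat_r; lra.
Qed.

(* Faking starts later by [tilt * RInt faking_cost b p], which is worth [disc b]
   per unit, whereas the loss after [b] is discounted: from [m] on by an extra
   factor [q]. *)
Lemma delegation_gain (m1 m q : R) :
  b <= m1 -> m1 < m -> m < p -> q = exp (- (rho M * (m - m1))) ->
  q * (c - p) < (1 - q) * (p - m) ->
  first_best_payoff M theta a < u_P M c thetaI theta.
Proof.
  intros bm1 m1m mp eq_q hq.
  assert (ht : mu M < theta < 1) by lra.
  assert (hi : mu M < thetaI < 1) by lra.
  destruct (tau_M_spec theta ht A1 hsb) as [ha _].
  destruct (tau_M_spec thetaI hi A1I sigma_bar_lower) as [hb _].
  pose proof tau_P_increases as pc; destruct RInt_fake_haz_total as [Ta Tb].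
  pose proof tau_M_increases as ab; pose proof tilt_pos as d0.
  pose proof (disc_pos b) as D0.
  assert (q0 : 0 < q) by (rewrite eq_q; apply exp_pos).
  rewrite u_P_during by (auto using sigma_bar_lower; lra).
  rewrite !first_best_flow by lra.
  rewrite (RInt_split _ (flow_continuous theta) a 0 b).
  rewrite (RInt_split _ (post_flow_continuous thetaI theta) m b c).
  assert (gain : (theta - mu M) * disc b * RInt (fake_haz theta) a b
                 <= RInt (flow theta) a b).
  { rewrite <- RInt_Rmult by apply fake_haz_continuous.
    apply RInt_le; [lra| | |].
    - apply ex_RInt_cont; intros x; apply continuous_Rmult;
        [apply continuous_Rconst|apply fake_haz_continuous].
    - apply ex_RInt_cont, flow_continuous.
    - intros x hx.
      replace (flow theta x) with ((theta - mu M) * disc x * fake_haz theta x)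
        by (unfold flow, fake_haz; field; lra).
      assert (0 < fake_haz theta x) by (apply fake_haz_pos; auto; lra).
      apply Rmult_le_compat_r; [lra|]; apply Rmult_le_compat_l; [lra|].
      apply disc_decr; lra. }
  (* Equate the two totals: the hazard for [theta] on [[a, b]] is the tilt on [[b, p]] plus the
     nonnegative hazard for [thetaI] on [[p, c]]. *)
  assert (delay : tilt * RInt faking_cost b p <= RInt (fake_haz theta) a b).
  { pose proof (RInt_fake_haz_ge0 p c ltac:(lra) ltac:(lra) ltac:(lra)) as h1.
    pose proof (RInt_fake_haz_tilt b p) as h2.
    rewrite (RInt_split _ (fake_haz_continuous theta) b) in Ta.
    rewrite (RInt_split _ (fake_haz_continuous thetaI) p) in Tb.
    lra. }
  assert (l1 := RInt_post_flow_ge b m (disc b) ltac:(lra) ltac:(lra) ltac:(lra)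
    ltac:(lra) (fun x hx => disc_decr b x (proj1 hx))).
  assert (qb : 0 <= q * disc b) by (apply Rmult_le_pos; lra).
  (* As [b <= m1], times from [m] on lie at least [m - m1] after [b]. *)
  assert (dq : forall x, m <= x <= c -> disc x <= q * disc b)
    by (intros x hx; rewrite eq_q; apply disc_le; lra).
  assert (l2 := RInt_post_flow_ge m c (q * disc b) ltac:(lra) ltac:(lra)
    ltac:(lra) qb dq).
  pose proof (RInt_split _ faking_cost_continuous m b p) as s1.
  pose proof (RInt_split _ faking_cost_continuous p m c) as s2.
  assert (k1 : faking_cost p * (p - m) <= RInt faking_cost m p).
  { apply RInt_ge_const; [apply faking_cost_continuous|lra|].
    intros; apply faking_cost_decr; lra. }
  assert (k2 : RInt faking_cost p c <= faking_cost p * (c - p)).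
  { apply RInt_le_const; [apply faking_cost_continuous|lra|].
    intros; apply faking_cost_decr; lra. }
  assert (kp : 0 < faking_cost p) by (apply faking_cost_pos; lra).
  assert (q1 : q < 1) by nra.
  (* This amounts to [q] times the integral over [[p, c]] being below [1 - q] times that over
     [[m, p]]; bounding the decreasing cost by its value at [p] on both sides reduces it to [hq]. *)
  assert (net : RInt faking_cost b m + q * RInt faking_cost m c
                < RInt faking_cost b p).
  { rewrite s1, s2; nra. }
  set (A := (theta - mu M) * disc b) in *.
  assert (A0 : 0 < A) by (apply Rmult_lt_0_compat; lra).
  apply Rmult_lt_compat_l with (1 := d0) in net.
  assert (net' := Rmult_lt_compat_l A _ _ A0 (Rlt_le_trans _ _ _ net delay)).
  unfold A in *; nra.
Qed.

End TwoSafePayoffs.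

(** * Absence of overruling, and intermediaries close to the principal *)

(** The hazard is largest at 0, so one inequality there covers all faking times; outside them type-1
    news is conclusive. *)
Lemma never_overrules (theta vt : R) :
  mu M < vt <= theta -> theta < 1 -> assumption_A1 M vt ->
  sigma_man M < sigma_bar M vt ->
  (theta - vt) * (mu M * (1 - mu M) * haz 0) <= rho M * vt * (theta - mu M) ->
  never_tempted_to_overrule M vt theta.
Proof.
  intros hvt htheta A1 hsb h.
  assert (hv : mu M < vt < 1) by lra.
  destruct (tau_M_spec vt hv A1 hsb) as [hM _].
  intros [s|s|s] hs act; simpl in hs; destruct act; simpl; try lra.
  enough (theta <= mu1 M vt s) by lra.
  destruct (Rlt_le_dec s (tau_M M vt)) as [lt|ge].
  - rewrite mu1_before; auto; lra.
  - destruct (Req_dec s (tau_P M vt)) as [->|ne].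
    + rewrite mu1_tau_P; auto; lra.
    + apply mu1_during; auto; [lra|].
      apply Rle_trans with (2 := h).
      do 2 (apply Rmult_le_compat_l; [try apply Rmult_le_pos; lra|]).
      apply haz_decr_le; lra.
Qed.

(** Each requirement follows from strict inequalities, continuous in [thetaI], that hold at
    [thetaI = theta]; finitely many of them hold together on a neighbourhood. *)
Lemma delegation_near (theta : R) :
  mu M < theta < 1 -> assumption_A1 M theta -> assumption_A2 M theta ->
  sigma_man M < sigma_bar M theta ->
  locally theta (fun thetaI => thetaI < theta ->
    mu M < thetaI /\
    (assumption_A1 M thetaI /\ assumption_A2 M thetaI /\
     sigma_man M < sigma_bar M thetaI) /\
    first_best_payoff M theta (tau_M M theta) < delegation_payoff M thetaI theta /\
    never_tempted_to_overrule M thetaI theta).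
Proof.
  intros ht A1 A2 hsb.
  destruct (tau_P_spec theta A1) as [p0 hp].
  destruct (tau_M_spec theta ht A1 hsb) as [ha Ta].
  rewrite <- RInt_fake_haz in Ta.
  set (a := tau_M M theta) in *; set (p := tau_P M theta) in *.
  (* Any fixed [a < m1 < m < p] would do: [tau_M thetaI] ends up below [m1] and
     [tau_P thetaI] below [p + eta]. *)
  set (m1 := (2 * a + p) / 3); set (m := (a + 2 * p) / 3).
  assert (hm : a < m1 /\ m1 < m /\ m < p) by (unfold m1, m; lra).
  set (q := exp (- (rho M * (m - m1)))).
  assert (q0 : 0 < q) by apply exp_pos.
  assert (q1 : q < 1).
  { unfold q; rewrite <- exp_0; apply exp_increasing.
    assert (0 < rho M * (m - m1)) by (apply Rmult_lt_0_compat; lra); lra. }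
  (* With [c - p < eta] for the intermediary's [tau_P], [q < 1] yields the last premise of
     [delegation_gain]. *)
  set (eta := (1 - q) * (p - m)).
  assert (eta0 : 0 < eta) by (apply Rmult_lt_0_compat; lra).
  assert (gap : 0 < cum_sigma - RInt (fake_haz theta) m1 p).
  { rewrite <- Ta, (RInt_split _ (fake_haz_continuous theta) m1 a p).
    enough (0 < RInt (fake_haz theta) a m1) by lra.
    rewrite RInt_fake_haz; apply Rlt_0_minus, cum_fake_lt; auto; fold p; lra. }
  assert (cphi : continuous (phi_P M) theta).
  { apply derivable_continuous with (l := Derive (phi_P M) theta).
    apply Derive_correct; unfold phi_P; auto_derive.
    apply Rmult_integral_contrapositive; lra. }
  (* This serves twice: it bounds [tau_P M x] by [p + eta], and it keeps [phi_P M x] above the limit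
     hazard for (A1). *)
  assert (e1 : locally theta (fun x => haz (p + eta) < phi_P M x)).
  { apply locally_gt; auto; rewrite <- hp; apply haz_decr; lra. }
  assert (e2 : locally theta (fun x => phi_A M < phi_P M x)).
  { apply locally_gt; auto. }
  assert (e3 : locally theta (fun x => mu M < x)).
  { apply (locally_gt (fun x => x)); [apply continuous_Rid|lra]. }
  (* The tilt vanishes at [x = theta], leaving [gap]; the signs are reversed to fit [locally_gt].
     This feeds [tau_M_upper]. *)
  assert (e4 : locally theta (fun x => - (cum_sigma - RInt (fake_haz theta) m1 p)
            < - (tilt theta x * (faking_cost 0 * (p + eta))))).
  { apply locally_gt.
    - apply continuous_Ropp, continuous_Rmult; [|apply continuous_Rconst].
      apply derivable_continuous with (l := Derive (tilt theta) theta).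
      apply Derive_correct; unfold tilt; auto_derive.
      apply Rmult_integral_contrapositive; lra.
    - unfold tilt; rewrite Rminus_diag; unfold Rdiv; rewrite !Rmult_0_l; lra. }
  assert (e5 : locally theta (fun x =>
            0 < rho M * x * (theta - mu M)
                - (theta - x) * (mu M * (1 - mu M) * haz 0))).
  { apply locally_gt.
    - continuous_compound.
    - rewrite Rminus_diag, Rmult_0_l, Rminus_0_r.
      repeat apply Rmult_lt_0_compat; lra. }
  generalize (filter_and _ _ e1 (filter_and _ _ e2
    (filter_and _ _ e3 (filter_and _ _ e4 e5)))).
  apply filter_imp; intros x (h1 & h2 & h3 & h4 & h5) hx.
  assert (hxv : mu M < x < 1) by lra.
  assert (A1x : assumption_A1 M x).
  { split.
    - apply Rlt_trans with (phi_P M theta); [apply phi_P_lt; lra|apply A1].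
    - apply Rbar_le_lt_trans with (haz (p + eta)); [|exact h1].
      apply hazard_infty_le; lra. }
  assert (hI : mu M < x < theta) by lra.
  assert (hsx : sigma_man M < sigma_bar M x)
    by (apply (sigma_bar_lower theta x); auto; lra).
  assert (pc : p < tau_P M x) by (apply tau_P_increases; auto; lra).
  assert (cp : tau_P M x < p + eta).
  { destruct (tau_P_spec x A1x) as [c0 hc].
    destruct (Rlt_le_dec (tau_P M x) (p + eta)) as [|le]; auto.
    pose proof (haz_decr_le (p + eta) (tau_P M x) ltac:(lra) le); lra. }
  assert (bm : tau_M M x < m1).
  { apply (tau_M_upper theta x); auto; try lra.
    - fold a p; lra.
    - fold p; apply Rle_lt_trans with (tilt theta x * (faking_cost 0 * (p + eta)));
        [|lra].
      apply Rmult_le_compat_l; [apply Rlt_le, tilt_pos; lra|].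
      apply Rmult_le_compat_l; [|lra].
      apply Rlt_le, (faking_cost_pos theta x); auto; lra. }
  repeat split; auto; try apply A1x.
  - apply Rlt_le_trans with (u_P M (tau_P M x) x theta).
    + apply (delegation_gain theta x) with (m1 := m1) (m := m) (q := q);
        auto; fold p; try lra.
      fold eta; apply Rlt_trans with (q * eta); [apply Rmult_lt_compat_l; lra|].
      rewrite <- (Rmult_1_l eta) at 2; apply Rmult_lt_compat_r; lra.
    + destruct (tau_M_spec x hxv A1x hsx) as [hb _].
      apply delegation_payoff_ge; auto.
      intros s hs; apply (post_flow_le0 theta x); auto; lra.
  - apply never_overrules; auto; lra.
Qed.

End Model.

Theorem proposition6 (M : model) (theta : R)
  (htheta : 0 < theta < 1)
  (hbeta : 0 < beta M < theta)
  (hmu : beta M < mu M < theta)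
  (hrho : 0 < rho M)
  (hsigma : 0 < sigma_man M < 1)
  (hG : cdf_with_continuous_density (G M) (g M))
  (hG1 : forall t : R, G M t < 1)
  (hhazard : forall s t : R, 0 <= s -> s < t -> hazard M t < hazard M s)
  (hA1 : assumption_A1 M theta)
  (hA2 : assumption_A2 M theta)
  (hsigma_bar : sigma_man M < sigma_bar M theta) :
  delegation_payoff M theta theta = first_best_payoff M theta (tau_M M theta) /\
  exists thetaI_star : R, mu M < thetaI_star < theta /\
    forall thetaI : R, thetaI_star < thetaI < theta ->
      (assumption_A1 M thetaI /\ assumption_A2 M thetaI /\ sigma_man M < sigma_bar M thetaI) /\
      delegation_payoff M thetaI theta > delegation_payoff M theta theta /\
      never_tempted_to_overrule M thetaI theta.
Proof.
  assert (hbeta0 : 0 < beta M) by lra.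
  assert (hmu1 : beta M < mu M < 1) by lra.
  assert (htheta1 : mu M < theta < 1) by lra.
  assert (self : delegation_payoff M theta theta
                 = first_best_payoff M theta (tau_M M theta))
    by now apply delegation_payoff_self.
  split; [exact self|]; rewrite self.
  destruct (delegation_near M hbeta0 hmu1 hrho hsigma hG hG1 hhazard theta
              htheta1 hA1 hA2 hsigma_bar) as [eps near].
  pose proof (cond_pos eps) as eps0.
  (* The midpoint keeps the threshold above [mu M] when [eps] is large. *)
  exists (Rmax (theta - eps) ((mu M + theta) / 2)).
  pose proof (Rmax_l (theta - eps) ((mu M + theta) / 2)).
  pose proof (Rmax_r (theta - eps) ((mu M + theta) / 2)).
  split.
  - split; [lra|apply Rmax_lub_lt; lra].
  - intros x hx; destruct (near x) as [_ h]; [|lra|exact h].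
    change (Rabs (x - theta) < eps); apply Rabs_def1; lra.
Qed.
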